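(* Let $A, B \in \mathfrak{g}^*_{\rm adm}$ be admissible pseudo-Hermitian $n\times n$ matrices ($n=p+q$), and let $C=A+B$. For $M\in\{A,B,C\}$ let $\lambda_1(M),\dots,\lambda_p(M),\mu_1(M),\dots,\mu_q(M)$ be the eigenvalues of $M$, arranged so that $$\lambda_p(M)\ge\lambda_{p-1}(M)\ge\cdots\ge\lambda_1(M) > \mu_1(M) \ge \mu_2(M)\ge\cdots\ge \mu_q(M).$$ Then for every choice of $m$ integers $1\le i_1< i_2 < \cdots < i_m\le p$ and $\ell$ integers $1\le j_1 < j_2 <\cdots < j_\ell \le q$ we have $$\sum_{k=1}^m \lambda_{i_k}(C) \ge \sum_{k=1}^m \lambda_{i_k}(A) + \sum_{k=1}^m \lambda_k(B)$$ and $$\sum_{k=1}^\ell \mu_{j_k}(C) \le \sum_{k=1}^\ell \mu_{j_k}(A) + \sum_{k=1}^\ell \mu_k(B).$$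
   Context: Let $p,q$ be non-negative integers, $n=p+q$, and $J_{pq}=\mathrm{diag}(1,\dots,1,-1,\dots,-1)$ with $p$ entries $1$ followed by $q$ entries $-1$. Let $G=\mathrm{U}(p,q)$ be the group of complex $n\times n$ matrices $M$ with $MJ_{pq}M^*=J_{pq}$, where $M^*$ is the conjugate transpose. A complex $n\times n$ matrix $A$ is pseudo-Hermitian if $AJ_{pq}=J_{pq}A^*$; the real vector space of these matrices is denoted $\mathfrak{g}^*$. The set $\mathfrak{g}^*_{\rm adm}$ of admissible elements consists of those $A\in\mathfrak{g}^*$ for which there is $U\in G$ with $A=U\Lambda U^{-1}$, $\Lambda=\mathrm{diag}(\lambda_p,\dots,\lambda_1,\mu_1,\dots,\mu_q)$ real diagonal, $\lambda_p\ge\cdots\ge\lambda_1$, $\mu_1\ge\cdots\ge\mu_q$ and $\lambda_1>\mu_1$. Thus the $p$ numbers $\lambda_i$ are the $p$ largest eigenvalues of $A$ (with multiplicity) and the $q$ numbers $\mu_j$ are the $q$ smallest. The set $\mathfrak{g}^*_{\rm adm}$ is a convex cone, so $A+B\in\mathfrak{g}^*_{\rm adm}$ whenever $A,B\in\mathfrak{g}^*_{\rm adm}$. *)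

(* Defs.v *)
From HB Require Import structures.
From mathcomp Require Import all_boot all_order all_algebra.
From mathcomp Require Export reals.
From mathcomp Require Export complex.
Set Implicit Arguments.
Unset Strict Implicit.
Unset Printing Implicit Defensive.
Import Order.TTheory GRing.Theory Num.Theory.
Local Open Scope ring_scope.
Local Open Scope complex_scope.
Local Open Scope sesquilinear_scope.

Section PseudoHermitian.
Variables (R : realType) (p q : nat).
Implicit Types M A U : 'M[R[i]]_(p + q).

Definition Jpq : 'M[R[i]]_(p + q) :=
  diag_mx (row_mx (const_mx 1) (const_mx (- 1))).

(* [M ^t*] is the conjugate transpose. *)
Definition in_Upq U : Prop := U *m Jpq *m U ^t* = Jpq.

Definition pseudo_hermitian A : Prop := A *m Jpq = Jpq *m A ^t*.

(* Indices start at 0: [lam i] and [mu j] stand for $\lambda_{i+1}$ and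
   $\mu_{j+1}$. When p = 0 or q = 0 the condition $\lambda_1 > \mu_1$ is
   void. *)
Definition arranged (lam : 'I_p -> R) (mu : 'I_q -> R) : Prop :=
  [/\ forall i i' : 'I_p, (i <= i')%N -> lam i <= lam i',
      forall j j' : 'I_q, (j <= j')%N -> mu j' <= mu j
    & forall (i : 'I_p) (j : 'I_q), i = 0%N :> nat -> j = 0%N :> nat ->
        mu j < lam i].

(* The diagonal matrix with entries
   $\lambda_p, \dots, \lambda_1, \mu_1, \dots, \mu_q$. *)
Definition diag_lam_mu (lam : 'I_p -> R) (mu : 'I_q -> R)
    : 'M[R[i]]_(p + q) :=
  diag_mx (row_mx (\row_i (lam (rev_ord i))%:C) (\row_j (mu j)%:C)).

Definition admissible A : Prop :=
  pseudo_hermitian A /\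
  exists U (lam : 'I_p -> R) (mu : 'I_q -> R),
    [/\ in_Upq U, arranged lam mu
      & A = U *m diag_lam_mu lam mu *m invmx U].

(* The eigenvalues of M with algebraic multiplicity, in nonincreasing order.
   The order of [R[i]] is partial ([x <= y] requires equal imaginary parts),
   so the sorting is only meaningful when the spectrum is real. *)
Definition eigenvalues M : seq R[i] :=
  sort >=%R (sval (closed_field_poly_normal (char_poly M))).

(* For i < p, the (i+1)-st smallest of the p largest eigenvalues of M. *)
Definition eig_lambda M (i : nat) : R[i] := (eigenvalues M)`_(p - i.+1).

(* For j < q, the (j+1)-st largest of the q smallest eigenvalues of M. *)
Definition eig_mu M (j : nat) : R[i] := (eigenvalues M)`_(p + j).

Lemma char_poly_eigenvalues M :
  char_poly M = \prod_(z <- eigenvalues M) ('X - z%:P).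
Proof.
rewrite /eigenvalues; case: closed_field_poly_normal => s /= def_s.
rewrite (perm_big s) /= ?perm_sort //.
by rewrite {1}def_s (monicP (char_poly_monic M)) scale1r.
Qed.

Lemma Jpq_sqr : Jpq *m Jpq = 1%:M.
Proof.
rewrite /Jpq mulmx_diag -diag_const_mx; congr diag_mx.
apply/rowP => k; rewrite !mxE.
by case: splitP => k' _; rewrite !mxE ?mulr1 ?mulrNN ?mulr1.
Qed.

Lemma in_Upq_unitmx U : in_Upq U -> U \in unitmx.
Proof.
move=> UJU; suff /mulmx1_unit[] : U *m (Jpq *m U ^t* *m Jpq) = 1%:M by [].
by rewrite !mulmxA UJU Jpq_sqr.
Qed.

Lemma eigenvalues_arranged U (lam : 'I_p -> R) (mu : 'I_q -> R) :
  in_Upq U -> arranged lam mu ->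
  eigenvalues (U *m diag_lam_mu lam mu *m invmx U)
  = [seq (lam (rev_ord i))%:C | i <- enum 'I_p]
    ++ [seq (mu j)%:C | j <- enum 'I_q].
Proof.
move=> /in_Upq_unitmx Uunit [lam_mono mu_mono lam_mu].
set A := _ *m _ *m _; set s := _ ++ _.
have lt_mu_lam i j : mu j < lam i.
  have p_gt0 : (0 < p)%N by apply: leq_ltn_trans (ltn_ord i).
  have q_gt0 : (0 < q)%N by apply: leq_ltn_trans (ltn_ord j).
  apply: le_lt_trans (mu_mono (Ordinal q_gt0) j _) _ => //.
  by apply: lt_le_trans (lam_mono (Ordinal p_gt0) i _) => //; apply: lam_mu.
have charA : char_poly A = \prod_(z <- s) ('X - z%:P).
  have -> : char_poly A = char_poly (diag_lam_mu lam mu).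
    rewrite /char_poly /char_poly_mx.
    set D := map_mx _ (diag_lam_mu _ _).
    have UK : map_mx (@polyC R[i]) U *m map_mx (@polyC R[i]) (invmx U) = 1%:M.
      by rewrite -map_mxM mulmxV // map_mx1.
    have -> : 'X%:M - map_mx (@polyC R[i]) A =
        map_mx (@polyC R[i]) U *m ('X%:M - D) *m map_mx (@polyC R[i]) (invmx U).
      rewrite mulmxBr mulmxBl scalar_mxC -(mulmxA 'X%:M) UK mulmx1.
      by rewrite /A !map_mxM.
    rewrite !det_mulmx mulrAC -det_mulmx UK det1 mul1r //.
  rewrite char_poly_trig ?diag_mx_is_trig // big_split_ord big_cat.
  rewrite !big_map -!enumT !big_enum /=; congr (_ * _); apply: eq_bigr => k _.
    by rewrite !mxE eqxx mulr1n (unsplitK (inl _)) mxE.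
  by rewrite !mxE eqxx mulr1n (unsplitK (inr _)) mxE.
have sorted_s : sorted >=%R s.
  have -> : s = [seq x%:C | x <- [seq lam (rev_ord i) | i <- enum 'I_p]
                                 ++ [seq mu j | j <- enum 'I_q]].
    by rewrite /s map_cat -!map_comp.
  rewrite sorted_map sorted_pairwise; last first.
    by move=> y x z /= le_yx le_zy; apply: le_trans le_zy le_yx.
  have pairwise_enum n : pairwise ltn (map val (enum 'I_n)).
    by rewrite val_enum_ord -sorted_pairwise ?iota_ltn_sorted //; apply: ltn_trans.
  rewrite pairwise_cat; apply/and3P; split.
  - apply/allrelP => _ _ /mapP[i _ ->] /mapP[j _ ->] /=.
    by rewrite lecR ltW.
  - rewrite pairwise_map; move: (pairwise_enum p); rewrite pairwise_map.
    apply: sub_pairwise => i i' /= lt_ii'; rewrite lecR lam_mono //=.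
    by rewrite leq_sub2l // ltnS ltnW.
  - rewrite pairwise_map; move: (pairwise_enum q); rewrite pairwise_map.
    by apply: sub_pairwise => j j' /= lt_jj'; rewrite lecR mu_mono // ltnW.
have ge_trans : transitive (>=%R : rel R[i]).
  by move=> y x z /= le_yx le_zy; apply: le_trans le_zy le_yx.
rewrite -(sorted_sort ge_trans sorted_s); symmetry; apply/perm_sort_inP.
- have s_real z : z \in s -> z \is Num.real.
    by rewrite mem_cat => /orP[] /mapP[k _ ->]; rewrite complex_real.
  by move=> x y /s_real xR /s_real yR; rewrite orbC; apply: real_leVge.
- by move=> y x z _ _ _; apply: ge_trans.
- by move=> x y _ _; rewrite andbC => /le_anti.
- have: perm_eq s (eigenvalues A).
    by apply: prod_XsubC_eq; rewrite -char_poly_eigenvalues.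
  by rewrite perm_sym perm_sort perm_sym.
Qed.

Lemma eig_lambda_arranged U (lam : 'I_p -> R) (mu : 'I_q -> R) (i : 'I_p) :
  in_Upq U -> arranged lam mu ->
  eig_lambda (U *m diag_lam_mu lam mu *m invmx U) i = (lam i)%:C.
Proof.
move=> UJU lm; rewrite /eig_lambda eigenvalues_arranged // nth_cat.
rewrite size_map size_enum_ord rev_ord_proof.
rewrite (nth_map (rev_ord i)) ?size_enum_ord ?rev_ord_proof //.
by rewrite (nth_ord_enum _ (rev_ord i)) rev_ordK.
Qed.

Lemma eig_mu_arranged U (lam : 'I_p -> R) (mu : 'I_q -> R) (j : 'I_q) :
  in_Upq U -> arranged lam mu ->
  eig_mu (U *m diag_lam_mu lam mu *m invmx U) j = (mu j)%:C.
Proof.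
move=> UJU lm; rewrite /eig_mu eigenvalues_arranged // nth_cat.
rewrite size_map size_enum_ord ltnNge leq_addr /= addKn.
by rewrite (nth_map j) ?size_enum_ord // nth_ord_enum.
Qed.

End PseudoHermitian.

(* Main.v *)
Require Import Defs.
From mathcomp Require Import all_boot all_order all_algebra.
From mathcomp Require Import lra perm sesquilinear spectral.
From mathcomp Require Import reals.
From mathcomp Require Import complex.
Import Order.TTheory GRing.Theory Num.Theory.
Local Open Scope ring_scope.
Local Open Scope complex_scope.

(** For M admissible, M J is a Hermitian form congruent through U(p,q) to
    diag(lambda, -mu), and this congruence preserves J. Let W be the J-positive
    space spanned by the left eigenvectors of C = A + B for its p largest
    eigenvalues. On W the form J is an inner product, C J compresses to
    diag(lambda(C)), and by a Courant-Fischer argument the i-th eigenvalues of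
    the compressions of A J and B J are at least lambda_i(A) and lambda_i(B).
    Lidskii's inequality for Hermitian matrices concludes. The second inequality
    is the same argument on the J-negative eigenspace, with eigenvalues -mu_j.
    That C is itself admissible holds because M is admissible exactly when
    M J - s J is positive definite for some real s. *)

Section HermitianForms.
Set Implicit Arguments.
Unset Strict Implicit.
Unset Printing Implicit Defensive.
Local Open Scope sesquilinear_scope.
Variable R : realType.

Lemma lt_homo_inj m n (i : 'I_m -> 'I_n) :
  (forall k k' : 'I_m, (k < k')%N -> (i k < i k')%N) -> injective i.
Proof.
move=> hi k k' eq_i; case: (ltngtP k k') => [/hi|/hi|/val_inj //].
  by rewrite eq_i ltnn.
by rewrite eq_i ltnn.
Qed.

(** * Hermitian forms on row vectors and real diagonal matrices *)

Definition qform n (H : 'M[R[i]]_n) (x : 'rV[R[i]]_n) : R[i] :=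
  (x *m H *m x ^t*) 0 0.

Definition norm2 n (x : 'rV[R[i]]_n) : R[i] := \sum_k `|x 0 k| ^+ 2.

Definition real_diag n (a : 'I_n -> R) : 'M[R[i]]_n :=
  diag_mx (\row_k (a k)%:C).

Definition isotone n (a : 'I_n -> R) : Prop :=
  forall k k' : 'I_n, (k <= k')%N -> a k <= a k'.

(** Row vectors act from the left, so the eigenvector for [a k] is the [k]-th row of [V ^t*]. The
    ascending order agrees with that of the numbers lambda_1, ..., lambda_p. *)
Definition spectrum n (H : 'M[R[i]]_n) (a : 'I_n -> R) : Prop :=
  isotone a /\
  exists2 V, V \is unitarymx & H = V *m real_diag a *m V ^t*.

Lemma adjmxM m n r (A : 'M[R[i]]_(m, n)) (B : 'M[R[i]]_(n, r)) :
  (A *m B) ^t* = B ^t* *m A ^t*.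
Proof. by rewrite trmx_mul map_mxM. Qed.

Lemma adjmx_real_diag n (a : 'I_n -> R) : (real_diag a) ^t* = real_diag a.
Proof.
rewrite /real_diag tr_diag_mx map_diag_mx; congr diag_mx.
apply/rowP => k; rewrite !mxE.
by apply: conj_Creal; rewrite complex_real.
Qed.

Lemma eq_real_diag n (a b : 'I_n -> R) : a =1 b -> real_diag a = real_diag b.
Proof. by move=> eq_ab; congr diag_mx; apply/rowP => k; rewrite !mxE eq_ab. Qed.

Lemma real_diagM n (a b : 'I_n -> R) :
  real_diag a *m real_diag b = real_diag (fun k => a k * b k).
Proof.
rewrite mulmx_diag; congr diag_mx; apply/rowP => k.
by rewrite !mxE rmorphM.
Qed.

Lemma real_diagN n (a : 'I_n -> R) :
  real_diag (fun k => - a k) = - real_diag a.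
Proof.
rewrite /real_diag -linearN; congr diag_mx.
by apply/rowP => k; rewrite !mxE rmorphN.
Qed.

Lemma real_diag_shift n (a : 'I_n -> R) t :
  real_diag (fun k => a k + t) = real_diag a + t%:C%:M.
Proof.
rewrite /real_diag -diag_const_mx -linearD /=; congr diag_mx.
by apply/rowP => k; rewrite !mxE rmorphD.
Qed.

Lemma real_diag_unitmx n (a : 'I_n -> R) :
  (forall k, a k != 0) -> real_diag a \in unitmx.
Proof.
move=> a_neq0.
suff /mulmx1_unit[] : real_diag a *m real_diag (fun k => (a k)^-1) = 1%:M by [].
rewrite real_diagM -diag_const_mx; congr diag_mx; apply/rowP => k.
by rewrite !mxE divff.
Qed.

Lemma qform_congr m n (F : 'M[R[i]]_(m, n)) H x :
  qform (F *m H *m F ^t*) x = qform H (x *m F).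
Proof. by rewrite /qform adjmxM !mulmxA. Qed.

Lemma qform_diag n (d : 'rV[R[i]]_n) x :
  qform (diag_mx d) x = \sum_k d 0 k * `|x 0 k| ^+ 2.
Proof.
rewrite /qform mul_mx_diag mxE; apply: eq_bigr => k _.
by rewrite !mxE normCK mulrAC mulrC mulrA.
Qed.

Lemma qform_real_diag n (a : 'I_n -> R) x :
  qform (real_diag a) x = \sum_k (a k)%:C * `|x 0 k| ^+ 2.
Proof. by rewrite qform_diag; apply: eq_bigr => k _; rewrite mxE. Qed.

Lemma qform_diag_gt0 n (d x : 'rV[R[i]]_n) :
  (forall k, 0 < d 0 k) -> x != 0 -> 0 < qform (diag_mx d) x.
Proof.
move=> d_gt0 /rV0Pn[k xk_neq0]; rewrite qform_diag (bigD1 k) //=.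
rewrite ltr_wpDr ?mulr_gt0 ?exprn_gt0 ?normr_gt0 // sumr_ge0 // => l _.
by rewrite mulr_ge0 ?exprn_ge0 // ltW.
Qed.

Lemma qformD n (H H' : 'M[R[i]]_n) x :
  qform (H + H') x = qform H x + qform H' x.
Proof. by rewrite /qform mulmxDr mulmxDl mxE. Qed.

Lemma qformN n (H : 'M[R[i]]_n) x : qform (- H) x = - qform H x.
Proof. by rewrite /qform mulmxN mulNmx mxE. Qed.

Lemma qformZ n c (H : 'M[R[i]]_n) x : qform (c *: H) x = c * qform H x.
Proof. by rewrite /qform -scalemxAr -scalemxAl mxE. Qed.

Lemma norm2E n (x : 'rV[R[i]]_n) : norm2 x = (x *m x ^t*) 0 0.
Proof. by rewrite mxE; apply: eq_bigr => k _; rewrite !mxE normCK. Qed.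

Lemma qform1 n (x : 'rV[R[i]]_n) : qform 1%:M x = norm2 x.
Proof. by rewrite /qform mulmx1 norm2E. Qed.

Lemma qform_scalar n c (x : 'rV[R[i]]_n) : qform c%:M x = c * norm2 x.
Proof. by rewrite -scalemx1 qformZ qform1. Qed.

Lemma norm2_ge0 n (x : 'rV[R[i]]_n) : 0 <= norm2 x.
Proof. by apply: sumr_ge0 => k _; rewrite exprn_ge0. Qed.

Lemma norm2_0 n : norm2 (0 : 'rV[R[i]]_n) = 0.
Proof. by rewrite /norm2 big1 // => k _; rewrite mxE normr0 expr0n. Qed.

Lemma norm2_gt0 n (x : 'rV[R[i]]_n) : x != 0 -> 0 < norm2 x.
Proof.
rewrite -qform1 -diag_const_mx; apply: qform_diag_gt0 => k.
by rewrite mxE ltr01.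
Qed.

Lemma norm2_unitary n (V : 'M[R[i]]_n) x :
  V \is unitarymx -> norm2 (x *m V) = norm2 x.
Proof.
move=> Vu; rewrite !norm2E adjmxM mulmxA -(mulmxA x).
by rewrite (unitarymxP Vu) mulmx1.
Qed.

(** * Weighted sums of squares and the Courant-Fischer principle *)

Lemma le_weighted_sum n (a : 'I_n -> R) c (x : 'rV[R[i]]_n) :
  (forall k, x 0 k != 0 -> c <= a k) ->
  c%:C * norm2 x <= \sum_k (a k)%:C * `|x 0 k| ^+ 2.
Proof.
move=> ca; rewrite mulr_sumr; apply: ler_sum => k _.
have [->|/ca le_c] := eqVneq (x 0 k) 0; first by rewrite normr0 expr0n !mulr0.
by rewrite ler_wpM2r ?exprn_ge0 // lecR.
Qed.

Lemma ge_weighted_sum n (a : 'I_n -> R) c (x : 'rV[R[i]]_n) :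
  (forall k, x 0 k != 0 -> a k <= c) ->
  \sum_k (a k)%:C * `|x 0 k| ^+ 2 <= c%:C * norm2 x.
Proof.
move=> ca; rewrite mulr_sumr; apply: ler_sum => k _.
have [->|/ca le_c] := eqVneq (x 0 k) 0; first by rewrite normr0 expr0n !mulr0.
by rewrite ler_wpM2r ?exprn_ge0 // lecR.
Qed.

(** Dimension count: the vectors supported on [P] form a space of dimension [#|P|], and the
    vanishing at [Q] imposes only [#|Q|] linear conditions on it. *)
Lemma exists_supported m n (F : 'M[R[i]]_(m, n)) (P : {set 'I_m})
    (Q : {set 'I_n}) :
  (#|Q| < #|P|)%N ->
  exists x : 'rV_m, [/\ x != 0, forall k, x 0 k != 0 -> k \in P
    & forall l, l \in Q -> (x *m F) 0 l = 0].
Proof.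
move=> ltQP.
pose E : 'M[R[i]]_(#|P|, m) := \matrix_(b, k) (enum_val b == k)%:R.
pose K := \matrix_(b < #|P|, c < #|Q|) (E *m F) b (enum_val c).
have /rowV0Pn[y /sub_kermxP yK y_neq0] : kermx K != 0.
  rewrite -mxrank_eq0 mxrank_ker subn_eq0 -ltnNge.
  exact: leq_ltn_trans (rank_leq_col K) ltQP.
have yE b : (y *m E) 0 (enum_val b) = y 0 b.
  rewrite mxE (bigD1 b) //= mxE eqxx mulr1 big1 ?addr0 // => b' neq_b'.
  by rewrite mxE (inj_eq enum_val_inj) (negPf neq_b') mulr0.
exists (y *m E); split.
- apply: contraNneq y_neq0 => yE0; apply/eqP/rowP => b.
  by rewrite -yE yE0 !mxE.
- move=> k; apply: contraNT => kNP; rewrite mxE big1 // => b _.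
  rewrite mxE; case: eqP => [def_k|_]; last by rewrite mulr0.
  by case/negP: kNP; rewrite -def_k enum_valP.
- move=> l lQ; have /rowP/(_ (enum_rank_in lQ l)) := yK; rewrite -mulmxA !mxE.
  move=> y0; rewrite -[RHS]y0; apply: eq_bigr => b _.
  by rewrite [in RHS]mxE enum_rankK_in.
Qed.

Lemma card_ord_lt n k : (k <= n)%N -> #|[set l : 'I_n | (l < k)%N]| = k.
Proof.
move=> le_kn; rewrite cardsE -sum1_card.
by rewrite -(big_ord_widen n (fun=> 1%N) le_kn) sum_nat_const card_ord muln1.
Qed.

(** The first [k + 1] eigenvectors of [H] span a space on which the form is at most [a k] times the
    squared norm. At most [k] linear conditions, encoded by [F] and [Q], leave a nonzero vector in
    it. *)
Lemma courant_fischer m n H (a : 'I_m -> R) (F : 'M[R[i]]_(m, n))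
    (Q : {set 'I_n}) (k : 'I_m) :
  spectrum H a -> (#|Q| <= k)%N ->
  exists x : 'rV_m, [/\ x != 0, forall l, l \in Q -> (x *m F) 0 l = 0
    & qform H x <= (a k)%:C * norm2 x].
Proof.
move=> [a_iso [V Vu ->]] leQk.
have : (#|Q| < #|[set l : 'I_m | (l < k.+1)%N]|)%N by rewrite card_ord_lt.
case/(exists_supported (V ^t* *m F)) => y [y_neq0 ysupp yF0].
exists (y *m V ^t*); split.
- apply: contraNneq y_neq0 => yV0; apply/eqP.
  rewrite -(mulmx1 y) -(mulmx1C (unitarymxP Vu)) mulmxA.
  by rewrite yV0 mul0mx.
- by move=> l lQ; rewrite -mulmxA yF0.
- rewrite qform_congr qform_real_diag -(norm2_unitary (y *m _) Vu).
  apply: ge_weighted_sum => l.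
  rewrite -mulmxA (mulmx1C (unitarymxP Vu)) mulmx1 => /ysupp.
  by rewrite inE ltnS => /a_iso.
Qed.

Lemma spectrum_real_diag n (a : 'I_n -> R) :
  isotone a -> spectrum (real_diag a) a.
Proof.
move=> a_iso; split=> //; exists 1%:M.
  by apply/unitarymxP; rewrite trmx1 map_mx1 mulmx1.
by rewrite trmx1 map_mx1 mul1mx mulmx1.
Qed.

Lemma spectrum_monotone n H H' (a a' : 'I_n -> R) :
  spectrum H a -> spectrum H' a' -> (forall x, qform H x <= qform H' x) ->
  forall k, a k <= a' k.
Proof.
move=> [a_iso [V Vu ->]] spec' leHH' k.
(* Courant-Fischer is applied to [H'], with the conditions that [x] be orthogonal to the first [k]
   eigenvectors of [H]; on such [x] the form of [H] is at least [a k] times the squared norm. *)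
have : (#|[set l : 'I_n | (l < k)%N]| <= k)%N by rewrite card_ord_lt // ltnW.
case/(courant_fischer V spec') => x [x_neq0 xV0 leH'x].
rewrite -lecR -(ler_pM2r (norm2_gt0 x_neq0)).
apply: le_trans (le_trans (leHH' x) leH'x); rewrite qform_congr qform_real_diag.
rewrite -(norm2_unitary x Vu); apply: le_weighted_sum => l.
apply: contraNT => Nle; rewrite xV0 // inE ltnNge.
by apply: contra Nle => /a_iso.
Qed.

Lemma spectrum_trace n H (a : 'I_n -> R) :
  spectrum H a -> \tr H = (\sum_k a k)%:C.
Proof.
move=> [_ [V Vu ->]]; rewrite mxtrace_mulC mulmxA.
rewrite (mulmx1C (unitarymxP Vu)) mul1mx mxtrace_diag rmorph_sum.
by apply: eq_bigr => k _; rewrite mxE.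
Qed.

Lemma spectrum_shift n H (a : 'I_n -> R) t :
  spectrum H a -> spectrum (H + t%:C%:M) (fun k => a k + t).
Proof.
move=> [a_iso [V Vu ->]]; split=> [k k' /a_iso|]; first by rewrite lerD2r.
exists V => //; rewrite real_diag_shift mulmxDr mulmxDl; congr (_ + _).
by rewrite scalar_mxC -mulmxA (unitarymxP Vu) mulmx1.
Qed.

Lemma spectrum_opp n H (a : 'I_n -> R) :
  spectrum H a -> spectrum (- H) (fun k => - a (rev_ord k)).
Proof.
move=> [a_iso [V Vu ->]]; split=> [k k' lekk'|].
  by rewrite lerN2 a_iso //= leq_sub2l.
exists (colsub (@rev_ord n) V).
  apply/unitarymxP; rewrite -(unitarymxP Vu).
  apply/matrixP => k l; rewrite !mxE (reindex_inj (inv_inj (@rev_ordK n))) /=.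
  by apply: eq_bigr => s _; rewrite !mxE rev_ordK.
apply/matrixP => k l; rewrite !mul_mx_diag !mxE -sumrN.
rewrite (reindex_inj (inv_inj (@rev_ordK n))) /=.
by apply: eq_bigr => s _; rewrite !mxE rmorphN mulrN mulNr.
Qed.

(** * Spectral theorem, factorization of positive forms and Lidskii's inequality *)

Lemma spectral_theorem n (H : 'M[R[i]]_n) :
  H ^t* = H -> exists a, spectrum H a.
Proof.
move=> Hh; have Hherm : H \is hermsymmx.
  by apply/is_hermitianmxP; rewrite expr0 scale1r Hh.
have /orthomx_spectralP H_E := hermitian_normalmx Hherm.
have Vu := spectral_unitarymx H; rewrite invmx_unitary // in H_E.
have /mxOverP d_real := hermitian_spectral_diag_real Hherm.
set V := spectralmx H in Vu H_E; set d := spectral_diag H in d_real H_E.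
pose b := [tuple complex.Re (d 0 k) | k < n].
(* The spectral decomposition at hand is unsorted: [s] sorts the eigenvalues, and the rows of [V],
   which are the eigenvectors, are permuted by the same [s]. *)
have /tuple_permP[s sort_b] : perm_eq (sort <=%R b) b by rewrite perm_sort.
pose a k := tnth b (s k).
exists a; split.
  move=> k k' lekk'.
  have a_nth (l : 'I_n) : a l = nth 0 (sort <=%R b) l.
    by rewrite sort_b -tnth_nth tnth_mktuple.
  rewrite !a_nth (sorted_leq_nth le_trans lexx) ?sort_le_sorted //.
  - by rewrite inE size_sort size_tuple.
  - by rewrite inE size_sort size_tuple.
exists ((row_perm s V) ^t*).
  rewrite trmxC_unitary; apply/unitarymxP.
  rewrite row_permE adjmxM mulmxA -(mulmxA _ V) (unitarymxP Vu) mulmx1.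
  by rewrite tr_perm_mx map_perm_mx -perm_mxM mulgV perm_mx1.
rewrite trmxCK {1}H_E; apply/matrixP => k l; rewrite !mul_mx_diag !mxE.
rewrite (reindex_inj (@perm_inj _ s)) /=.
by apply: eq_bigr => r _; rewrite !mxE /a tnth_mktuple RRe_real.
Qed.

Lemma pos_def_factor n (P : 'M[R[i]]_n) :
  P ^t* = P -> (forall x, x != 0 -> 0 < qform P x) ->
  exists2 T, T \in unitmx & P = T *m T ^t*.
Proof.
move=> Ph P_gt0.
have [e [_ [V Vu P_E]]] := spectral_theorem Ph.
have e_gt0 k : 0 < e k.
  (* [x *m invmx V] is the eigenvector for [e k], so the form takes the value [e k] there. *)
  pose x : 'rV[R[i]]_n := delta_mx 0 k; have x_neq0 : x != 0.
    by apply/eqP => /rowP/(_ k); rewrite !mxE !eqxx; apply/eqP/oner_neq0.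
  have Vunit := unitarymx_unit Vu.
  have xV_neq0 : x *m invmx V != 0.
    by apply: contraNneq x_neq0 => xV0; rewrite -(mulmxKV Vunit x) xV0 mul0mx.
  have := P_gt0 _ xV_neq0; rewrite P_E qform_congr mulmxKV // qform_real_diag.
  rewrite (bigD1 k) //= big1 => [|l neq_lk].
    by rewrite mxE !eqxx normr1 expr1n mulr1 addr0 ltcR.
  by rewrite mxE (negPf neq_lk) andbF normr0 expr0n mulr0.
exists (V *m real_diag (fun k => Num.sqrt (e k))).
  rewrite unitmx_mul unitarymx_unit // real_diag_unitmx // => k.
  by rewrite gt_eqF // sqrtr_gt0.
rewrite P_E adjmxM adjmx_real_diag !mulmxA -[in RHS](mulmxA V) real_diagM.
rewrite (@eq_real_diag _ (fun k => _ * _) e) // => k.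
by rewrite -expr2 sqr_sqrtr // ltW.
Qed.

(* Li and Mathias' proof: truncating [HB] at its [m]-th eigenvalue [t] lowers
   [HA + HB] to a matrix whose eigenvalues [c'] satisfy [c' k <= a k + t], so the
   sum of [a k + t - c' k] over the indices [i k] is at most the sum over all
   indices, which is given by traces. *)
Lemma lidskii n (HA HB : 'M[R[i]]_n) (a b c : 'I_n -> R) m (i : 'I_m -> 'I_n)
    (f : 'I_m -> 'I_n) :
  spectrum HA a -> spectrum HB b -> spectrum (HA + HB) c ->
  injective i -> (forall k, f k = k :> nat) ->
  \sum_k a (i k) + \sum_k b (f k) <= \sum_k c (i k).
Proof.
case: m i f => [|m] i f specA specB specC i_inj fE.
  by rewrite !big_ord0 addr0.
pose t := b (f ord_max); pose b' k := Num.min (b k) t.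
have [b_iso [V Vu HB_E]] := specB.
pose HB' := V *m real_diag b' *m V ^t*.
have specB' : spectrum HB' b'.
  split; last exact: (ex_intro2 _ _ V Vu erefl).
  by move=> k k' /b_iso le_bb; rewrite /b' le_min !ge_min le_bb lexx orbT.
have [a_iso [W Wu HA_E]] := specA.
have [c' specC'] : exists c', spectrum (HA + HB') c'.
  apply: spectral_theorem; rewrite linearD /= map_mxD HA_E /HB' !adjmxM.
  by rewrite !trmxCK !adjmx_real_diag !mulmxA.
have le_c'c : forall k, c' k <= c k.
  apply: (spectrum_monotone specC' specC) => x.
  rewrite !qformD lerD2l HB_E /HB' !qform_congr !qform_real_diag.
  apply: ler_sum => k _; rewrite ler_wpM2r ?exprn_ge0 // lecR.
  by rewrite /b' ge_min lexx.
have le_c'a : forall k, c' k <= a k + t.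
  apply: (spectrum_monotone specC' (spectrum_shift t specA)) => x.
  rewrite !qformD lerD2l qform_scalar /HB' qform_congr qform_real_diag.
  rewrite -(norm2_unitary x Vu); apply: ge_weighted_sum => k _.
  by rewrite /b' ge_min lexx orbT.
have tr_c' : \sum_k (a k + b' k - c' k) = 0.
  have := mxtraceD HA HB'; rewrite (spectrum_trace specA).
  rewrite (spectrum_trace specB') (spectrum_trace specC').
  rewrite -rmorphD => /complexI eq_tr.
  by rewrite sumrB big_split /= eq_tr subrr.
have f_inj : injective f.
  by move=> k k' eq_f; apply: val_inj; rewrite /= -!fE eq_f.
have sum_im (g : 'I_m.+1 -> 'I_n) (h : 'I_n -> R) : injective g ->
    \sum_k h (g k) = \sum_(k in [set g k | k : 'I_m.+1]) h k.
  by move=> g_inj; rewrite big_imset //= => k k' _ _; apply: g_inj.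
apply: le_trans (ler_sum _ (fun k _ => le_c'c (i k))).
(* Up to index [m] truncation changes nothing; beyond it [b k] is at least [t], so [b' k - t]
   vanishes. *)
have sum_b' : \sum_k (b' k - t) = \sum_k (b (f k) - t).
  rewrite (sum_im f (fun k => b k - t)) // [RHS]big_mkcond /=.
  apply: eq_bigr => k _; rewrite /b' /t; case: imsetP => [[k' _ ->]|k_notin].
    by rewrite min_l // b_iso // !fE -ltnS.
  rewrite min_r ?subrr // b_iso // leqNgt fE; apply/negP => lt_km.
  case: k_notin; exists (Ordinal (leqW lt_km)) => //.
  by apply: val_inj; rewrite /= fE.
have sum_a : \sum_k (a (i k) + t - c' (i k)) <= \sum_k (a k + t - c' k).
  rewrite (sum_im i (fun k => a k + t - c' k)) // big_mkcond /=.
  by apply: ler_sum => k _; case: ifP => // _; rewrite subr_ge0.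
have tr_split : \sum_k (a k + t - c' k) + \sum_k (b (f k) - t) = 0.
  rewrite -sum_b' -big_split -[RHS]tr_c'; apply: eq_bigr => k _ /=.
  by lra.
(* The zero on the right is replaced by the trace identity; after [sum_a] both sides are sums over
   the same [m + 1] indices, and the copies of [t] cancel termwise. *)
rewrite -subr_le0 -[leRHS]tr_split.
apply: le_trans (lerD sum_a (lexx _)); rewrite -big_split -sumrB -big_split /=.
by apply: ler_sum => k _; lra.
Qed.

(** * Compressions of Hermitian matrices *)

Lemma adjmx_compression m n (G : 'M[R[i]]_(m, n)) L :
  L ^t* = L -> (G *m L *m G ^t*) ^t* = G *m L *m G ^t*.
Proof. by move=> Lh; rewrite !adjmxM trmxCK Lh mulmxA. Qed.

(** Courant-Fischer gives [x] for which [x *m G *m F1] has its first [k] coordinates zero. With n1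
    and n2 the squared norms of [x *m G *m F1] and [x *m G *m F2], the form of [L] at [x *m G] is at
    least [a k] n1 - [s] n2, hence at least [a k] (n1 - n2), which is [a k * norm2 x]. Keeping [F1]
    and [F2] abstract serves both the positive and the negative eigenspace. *)
Lemma compression_spectrum_ge p q n (G : 'M[R[i]]_(p, n)) L
    (F1 : 'M[R[i]]_(n, p)) (F2 : 'M[R[i]]_(n, q)) a b s :
  L ^t* = L -> isotone a -> (forall i, s <= a i) -> (forall j, b j <= s) ->
  (forall v, qform L v = \sum_i (a i)%:C * `|(v *m F1) 0 i| ^+ 2
                         - \sum_j (b j)%:C * `|(v *m F2) 0 j| ^+ 2) ->
  (forall x, norm2 x = norm2 (x *m G *m F1) - norm2 (x *m G *m F2)) ->
  exists2 nu, spectrum (G *m L *m G ^t*) nu & forall k, a k <= nu k.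
Proof.
move=> Lh a_iso le_sa le_bs LE norm2_G.
have [nu spec_nu] := spectral_theorem (adjmx_compression G Lh).
exists nu => // k.
have : (#|[set l : 'I_p | (l < k)%N]| <= k)%N by rewrite card_ord_lt // ltnW.
case/(courant_fischer (G *m F1) spec_nu) => x [x_neq0 xF1 le_nu].
rewrite -lecR -(ler_pM2r (norm2_gt0 x_neq0)); apply: le_trans le_nu.
rewrite qform_congr LE norm2_G mulrBr lerB //.
  apply: le_weighted_sum => l; apply: contraNT; rewrite -mulmxA => le_akl.
  by rewrite xF1 // inE ltnNge; apply: contra le_akl => /a_iso.
apply: (@le_trans _ _ (s%:C * norm2 (x *m G *m F2))).
  exact: ge_weighted_sum.
by rewrite ler_wpM2r ?norm2_ge0 // lecR.
Qed.

(** Lower bounds suffice for the two summands, since they stand on the smaller side of Lidskii's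
    inequality; the spectrum of the sum has to be exact. *)
Lemma compression_lidskii r n (G : 'M[R[i]]_(r, n)) (L L' : 'M[R[i]]_n)
    (a b c : 'I_r -> R) m (i f : 'I_m -> 'I_r) :
  (exists2 nu, spectrum (G *m L *m G ^t*) nu & forall k, a k <= nu k) ->
  (exists2 nu, spectrum (G *m L' *m G ^t*) nu & forall k, b k <= nu k) ->
  spectrum (G *m (L + L') *m G ^t*) c ->
  injective i -> (forall k, f k = k :> nat) ->
  \sum_k a (i k) + \sum_k b (f k) <= \sum_k c (i k).
Proof.
move=> [nu spec_nu le_a_nu] [nu' spec_nu' le_b_nu']; rewrite mulmxDr mulmxDl.
move=> spec_c i_inj fE.
apply: le_trans (lidskii spec_nu spec_nu' spec_c i_inj fE).
by apply: lerD; apply: ler_sum => k _.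
Qed.

End HermitianForms.

(** * The form [J] and the diagonalization of admissible matrices *)

Section PseudoHermitianForms.
Set Implicit Arguments.
Unset Strict Implicit.
Unset Printing Implicit Defensive.
Local Open Scope sesquilinear_scope.
Variables (R : realType) (p q : nat).
Local Notation J := (Jpq R p q).
Implicit Types (M U : 'M[R[i]]_(p + q)) (lam : 'I_p -> R) (mu : 'I_q -> R).

(** Unlike in [diag_lam_mu], the entries of [lam] are not reversed, so an ascending [lam] stays
    ascending along the diagonal, as [spectrum] demands. *)
Definition block_diag lam mu : 'M[R[i]]_(p + q) :=
  diag_mx (row_mx (\row_i (lam i)%:C) (\row_j (mu j)%:C)).

Lemma qform_block_diag lam mu (w : 'rV[R[i]]_(p + q)) :
  qform (block_diag lam mu) w =
  \sum_i (lam i)%:C * `|lsubmx w 0 i| ^+ 2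
  + \sum_j (mu j)%:C * `|rsubmx w 0 j| ^+ 2.
Proof.
rewrite qform_diag big_split_ord /=; congr (_ + _); apply: eq_bigr => k _.
  by rewrite row_mxEl !mxE.
by rewrite row_mxEr !mxE.
Qed.

Lemma Jpq_block : J = block_diag (fun=> 1) (fun=> - 1).
Proof.
rewrite /Jpq /block_diag; congr (diag_mx (row_mx _ _)); apply/rowP => k.
  by rewrite !mxE.
by rewrite !mxE rmorphN1.
Qed.

Lemma adjmx_block_diag lam mu : (block_diag lam mu) ^t* = block_diag lam mu.
Proof.
rewrite /block_diag tr_diag_mx map_diag_mx map_row_mx.
congr (diag_mx (row_mx _ _)); apply/rowP => k; rewrite !mxE;
  by apply: conj_Creal; rewrite complex_real.
Qed.

Lemma mul_block_diag_Jpq lam mu :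
  block_diag lam mu *m J = block_diag lam (fun j => - mu j).
Proof.
rewrite /block_diag /Jpq mulmx_diag; congr diag_mx; apply/rowP => k.
rewrite !mxE; case: splitP => k' _; rewrite !mxE ?mulr1 //.
by rewrite mulrN1 rmorphN.
Qed.

Lemma qform_Jpq (w : 'rV[R[i]]_(p + q)) :
  qform J w = norm2 (lsubmx w) - norm2 (rsubmx w).
Proof.
rewrite Jpq_block qform_block_diag -sumrN.
by congr (_ + _); apply: eq_bigr => k _; rewrite ?rmorphN1 ?mul1r ?mulN1r.
Qed.

Lemma adjmx_Jpq : J ^t* = J.
Proof. by rewrite Jpq_block adjmx_block_diag. Qed.

Lemma pseudo_hermitianP M : pseudo_hermitian M <-> (M *m J) ^t* = M *m J.
Proof. by rewrite adjmxM adjmx_Jpq; split=> /esym. Qed.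

Lemma in_Upq_invmx U : in_Upq U -> invmx U = J *m U ^t* *m J.
Proof.
move=> UJU; have Uunit := in_Upq_unitmx UJU.
by rewrite -[RHS](mulKmx Uunit) 2![U *m _]mulmxA UJU Jpq_sqr mulmx1.
Qed.

(** Since the inverse of [U] is [J *m U ^t* *m J], multiplying M = U D U^-1 by [J] on the right
    turns the similarity into a congruence. *)
Lemma admissible_diag M : admissible M ->
  exists U lam mu,
  [/\ in_Upq U, arranged lam mu,
      M *m J = U *m block_diag lam (fun j => - mu j) *m U ^t*,
      forall i : 'I_p, eig_lambda M i = (lam i)%:C
    & forall j : 'I_q, eig_mu M j = (mu j)%:C].
Proof.
move=> [_ [U [lam [mu [UJU lam_mu ->]]]]].
(* [g] reverses the first [p] columns of [U], which puts the lambda_i in ascending order. It only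
   permutes equal entries of [J], so the new matrix stays in U(p,q). *)
pose g (k : 'I_(p + q)) : 'I_(p + q) :=
  match split k with inl i => lshift q (rev_ord i) | inr j => rshift p j end.
have gK : involutive g.
  move=> k; rewrite -[RHS]splitK /g; case: (split k) => k' /=.
    by rewrite (unsplitK (inl _)) rev_ordK.
  by rewrite (unsplitK (inr _)).
have colsub_row (d1 : 'rV[R[i]]_p) (d2 : 'rV_q) :
    colsub g (row_mx d1 d2) = row_mx (colsub (@rev_ord p) d1) d2.
  apply/rowP => k; rewrite /g !mxE; case: (split k) => k'.
    by rewrite (unsplitK (inl _)) mxE.
  by rewrite (unsplitK (inr _)).
have colsub_diag d :
    U *m diag_mx d *m U ^t* =
    colsub g U *m diag_mx (colsub g d) *m (colsub g U) ^t*.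
  apply/matrixP => k l; rewrite !mul_mx_diag !mxE.
  by rewrite (reindex_inj (inv_inj gK)); apply: eq_bigr => r _; rewrite !mxE.
exists (colsub g U), lam, mu; split=> //.
- rewrite /in_Upq -[RHS]UJU /Jpq [RHS]colsub_diag colsub_row.
  by congr (_ *m diag_mx (row_mx _ _) *m _); apply/rowP => k; rewrite !mxE.
- rewrite in_Upq_invmx // !mulmxA -(mulmxA _ J J) Jpq_sqr mulmx1 -(mulmxA U).
  rewrite -/(block_diag (lam \o @rev_ord p) mu) mul_block_diag_Jpq.
  rewrite colsub_diag colsub_row.
  congr (_ *m diag_mx (row_mx _ _) *m _); apply/rowP => k.
  by rewrite !mxE rev_ordK.
- by move=> i; rewrite eig_lambda_arranged.
- by move=> j; rewrite eig_mu_arranged.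
Qed.

(** * Admissibility as positive definiteness of a shifted form *)

Lemma arranged_separation lam mu : arranged lam mu ->
  exists s, (forall i, s < lam i) /\ (forall j, mu j < s).
Proof.
move=> [lam_mono mu_mono lam_mu].
(* If one family is empty, any number strictly beyond the other one separates; otherwise the
   midpoint of lambda_1 and mu_1 does. *)
have ord_empty n : n = 0%N -> 'I_n -> False by move=> -> [].
have [p0|p_gt0] := posnP p; have [q0|q_gt0] := posnP q.
- exists 0; split=> [i|j]; first by case: (ord_empty _ p0 i).
  by case: (ord_empty _ q0 j).
- exists (mu (Ordinal q_gt0) + 1); split=> [i|j].
    by case: (ord_empty _ p0 i).
  by apply: le_lt_trans (mu_mono (Ordinal q_gt0) j _) _; rewrite ?ltrDl.
- exists (lam (Ordinal p_gt0) - 1); split=> [i|j].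
    by apply: lt_le_trans (lam_mono (Ordinal p_gt0) i _); rewrite ?gtrBl.
  by case: (ord_empty _ q0 j).
have lt0 := lam_mu (Ordinal p_gt0) (Ordinal q_gt0) erefl erefl.
exists ((lam (Ordinal p_gt0) + mu (Ordinal q_gt0)) / 2); split=> [i|j].
  by have := lam_mono (Ordinal p_gt0) i (leq0n _); lra.
by have := mu_mono (Ordinal q_gt0) j (leq0n _); lra.
Qed.

(** For [s] between the mu_j and the lambda_i, M J - s J is congruent to the diagonal matrix with
    entries lambda_i - s and s - mu_j, all positive. *)
Lemma admissible_pos M : admissible M ->
  exists s : R, forall v, v != 0 -> 0 < qform (M *m J - s%:C *: J) v.
Proof.
move=> /admissible_diag[U [lam [mu [UJU lam_mu -> _ _]]]].
have [s [lt_s_lam lt_mu_s]] := arranged_separation lam_mu.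
exists s => v v_neq0; set w := v *m U.
have w_neq0 : w != 0.
  apply: contraNneq v_neq0 => w0.
  by rewrite -(mulmxK (in_Upq_unitmx UJU) v) -/w w0 mul0mx.
set D := block_diag _ _.
have -> : U *m D *m U ^t* - s%:C *: J = U *m (D - s%:C *: J) *m U ^t*.
  by rewrite mulmxBr mulmxBl -scalemxAr -scalemxAl UJU.
rewrite qform_congr -/w Jpq_block -linearZ -linearB /=.
apply: qform_diag_gt0 w_neq0 => k; rewrite !mxE.
case: splitP => k' _; rewrite !mxE.
  by rewrite mulr1 subr_gt0 ltcR.
by rewrite rmorphN1 mulrN1 opprK -rmorphD ltcR addrC subr_gt0.
Qed.

(** Sylvester's law of inertia with unitary diagonalization: the signs follow from Courant-Fischer,
    as [J] is definite on each of the two coordinate subspaces. *)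
Lemma sylvester_Jpq (T : 'M[R[i]]_(p + q)) : T \in unitmx ->
  exists W (d : 'I_(p + q) -> R),
  [/\ W \is unitarymx, T ^t* *m J *m T = W *m real_diag d *m W ^t*,
      forall k k' : 'I_(p + q), (k <= k')%N -> d k' <= d k,
      forall i, 0 < d (lshift q i) & forall j, d (rshift p j) < 0].
Proof.
move=> Tunit; set K := _ *m T.
have Kh : K ^t* = K.
  by have := adjmx_compression (T ^t*) adjmx_Jpq; rewrite trmxCK.
(* Diagonalizing [- K] in ascending order makes the eigenvalues of [K] descend, so that the [p]
   positive ones come first. *)
have [a spec_a] : exists a, spectrum (- K) a.
  by apply: spectral_theorem; rewrite linearN /= map_mxN Kh.
have Tadj_unit : T ^t* \in unitmx by rewrite map_unitmx unitmx_tr.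
have qform_K x : qform K x = qform J (x *m T ^t*).
  by rewrite -qform_congr trmxCK.
have xT_neq0 (x : 'rV_(p + q)) : x != 0 -> x *m T ^t* != 0.
  by apply: contraNneq => xT0; rewrite -(mulmxK Tadj_unit x) xT0 mul0mx.
(* The [p] conditions kill the first block of [x *m T ^t*], where [- J] is then the squared norm of
   the second block. *)
have a_gt0 (j : 'I_q) : 0 < a (rshift p j).
  have leQ : (#|[set lshift q i | i : 'I_p]| <= rshift p j)%N.
    by rewrite card_imset ?card_ord ?leq_addr //; apply: lshift_inj.
  have [x [x_neq0 xT0]] := courant_fischer (T ^t*) spec_a leQ.
  have lx0 : lsubmx (x *m T ^t*) = 0.
    by apply/rowP => i; rewrite [RHS]mxE mxE xT0 // imset_f.
  rewrite qformN qform_K qform_Jpq lx0 norm2_0 sub0r opprK => le_x.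
  rewrite -ltcR -(pmulr_lgt0 _ (norm2_gt0 x_neq0)); apply: lt_le_trans le_x.
  apply/norm2_gt0; apply: contraNneq (xT_neq0 _ x_neq0) => rx0.
  by rewrite -[_ *m _]hsubmxK lx0 rx0 row_mx0.
(* The same argument for [K]: its spectrum lists the negated [a] in reverse, and the reversed index
   of [lshift q i] is at least [q], enough to kill the second block. *)
have a_lt0 (i : 'I_p) : a (lshift q i) < 0.
  have leQ : (#|[set rshift p j | j : 'I_q]| <= rev_ord (lshift q i))%N.
    rewrite card_imset ?card_ord /=; last exact: rshift_inj.
    by rewrite addnC -addnBA // leq_addr.
  have := spectrum_opp spec_a; rewrite opprK => spec_K.
  have [x [x_neq0 xT0]] := courant_fischer (T ^t*) spec_K leQ.
  have rx0 : rsubmx (x *m T ^t*) = 0.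
    by apply/rowP => j; rewrite [RHS]mxE mxE xT0 // imset_f.
  rewrite qform_K qform_Jpq rx0 norm2_0 subr0 rev_ordK => le_x.
  rewrite -oppr_gt0 -ltcR -(pmulr_lgt0 _ (norm2_gt0 x_neq0)).
  apply: lt_le_trans le_x.
  apply/norm2_gt0; apply: contraNneq (xT_neq0 _ x_neq0) => lx0.
  by rewrite -[_ *m _]hsubmxK lx0 rx0 row_mx0.
have [a_iso [W Wu K_E]] := spec_a.
exists W, (fun k => - a k); split.
- exact: Wu.
- by rewrite -[K]opprK K_E real_diagN mulmxN mulNmx.
- by move=> k k' /a_iso; rewrite lerN2.
- by move=> i; rewrite oppr_gt0.
- by move=> j; rewrite oppr_lt0.
Qed.

(** Simultaneous diagonalization: with P = M J - s J = S S^* and S^* J S = D real diagonal, M = S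
    S^* J + s gives M S = S (D + s). Rescaling the columns of S puts it in U(p,q). *)
Lemma pos_admissible M (s : R) : pseudo_hermitian M ->
  (forall v, v != 0 -> 0 < qform (M *m J - s%:C *: J) v) -> admissible M.
Proof.
move=> Mph P_gt0.
have Ph : (M *m J - s%:C *: J) ^t* = M *m J - s%:C *: J.
  rewrite linearB /= map_mxB (pseudo_hermitianP M).1 // linearZ /= map_mxZ.
  rewrite adjmx_Jpq; congr (_ - _ *: _).
  by apply: conj_Creal; rewrite complex_real.
have [T Tunit P_TT] := pos_def_factor Ph P_gt0.
have [W [d [Wu K_E d_anti d_gt0 d_lt0]]] := sylvester_Jpq Tunit.
have K_W : W ^t* *m (T ^t* *m J *m T) *m W = real_diag d.
  rewrite K_E !mulmxA (mulmx1C (unitarymxP Wu)) mul1mx.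
  by rewrite -mulmxA (mulmx1C (unitarymxP Wu)) mulmx1.
have [S [Sunit P_SS SJS]] : exists S : 'M[R[i]]_(p + q),
    [/\ S \in unitmx, M *m J - s%:C *: J = S *m S ^t*
      & S ^t* *m J *m S = real_diag d].
  exists (T *m W); split.
  - by rewrite unitmx_mul Tunit unitarymx_unit.
  - by rewrite P_TT adjmxM mulmxA -(mulmxA T) (unitarymxP Wu) mulmx1.
  - by rewrite adjmxM -K_W !mulmxA.
(* Scaling column [k] by the inverse square root of the absolute value of [d k] leaves only the sign
   of [d k], which is the diagonal entry of [J]. *)
pose u k := Num.sqrt `|d k|^-1; pose U := S *m real_diag u.
have UJU : U ^t* *m J *m U = J.
  have -> : U ^t* *m J *m U = real_diag u *m (S ^t* *m J *m S) *m real_diag u.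
    by rewrite adjmxM adjmx_real_diag !mulmxA.
  rewrite SJS !real_diagM; congr diag_mx; apply/rowP => k; rewrite !mxE.
  rewrite mulrAC -expr2 sqr_sqrtr ?invr_ge0 ?normr_ge0 //.
  case: splitP => k' def_k; rewrite !mxE.
    have -> : k = lshift q k' by apply: val_inj.
    by rewrite gtr0_norm // mulVf ?gt_eqF.
  have -> : k = rshift p k' by apply: val_inj.
  by rewrite ltr0_norm // invrN mulNr mulVf ?lt_eqF // rmorphN1.
have UJU' : in_Upq U.
  (* [J *m U ^t* *m J] is a left inverse of [U], hence also a right inverse; this turns U^* J U = J
     into U J U^* = J. *)
  have /mulmx1C UJUJ : J *m U ^t* *m J *m U = 1%:M.
    by rewrite -2!mulmxA (mulmxA _ J) UJU Jpq_sqr.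
  by rewrite /in_Upq -[RHS]mul1mx -UJUJ !mulmxA -[RHS]mulmxA Jpq_sqr mulmx1.
have M_E : M = S *m (S ^t* *m J) + s%:C%:M.
  rewrite mulmxA -P_SS mulmxBl -mulmxA -scalemxAl Jpq_sqr mulmx1 scalemx1.
  by rewrite subrK.
have MU : M *m U = U *m real_diag (fun k => d k + s).
  rewrite real_diag_shift {1}M_E mulmxDl mulmxDr scalar_mxC; congr (_ + _).
  rewrite /U -mulmxA (mulmxA _ S) SJS -mulmxA !real_diagM.
  by congr (_ *m diag_mx _); apply/rowP => k; rewrite !mxE mulrC.
split=> //.
(* The eigenvalues are [d k + s]: those with [d k] positive lie above [s] and form the lambda_i, the
   others lie below and form the mu_j. *)
exists U, (fun i => d (lshift q (rev_ord i)) + s),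
  (fun j => d (rshift p j) + s).
split=> //.
- split=> [i i' le_ii'|j j' le_jj'|i j _ _]; rewrite ?lerD2r ?ltrD2r.
  + by rewrite d_anti //= leq_sub2l.
  + by rewrite d_anti //= leq_add2l.
  + exact: lt_trans (d_lt0 j) (d_gt0 _).
- have -> : diag_lam_mu (fun i => d (lshift q (rev_ord i)) + s)
      (fun j => d (rshift p j) + s) = real_diag (fun k => d k + s).
    congr diag_mx; apply/rowP => k; rewrite !mxE.
    case: splitP => k' def_k; rewrite !mxE ?rev_ordK; congr (d _ + s)%:C;
      exact: val_inj.
  by rewrite -MU mulmxK // in_Upq_unitmx.
Qed.

(** The shifts add up: the form for [s + s'] is a sum of two positive definite forms. *)
Lemma admissibleD M M' : admissible M -> admissible M' -> admissible (M + M').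
Proof.
move=> Madm Madm'; have [[Mph _] [Mph' _]] := (Madm, Madm').
have [[s P_gt0] [s' P_gt0']] := (admissible_pos Madm, admissible_pos Madm').
apply: (@pos_admissible _ (s + s')) => [|v v_neq0].
  by rewrite /pseudo_hermitian mulmxDl Mph Mph' linearD /= map_mxD mulmxDr.
rewrite mulmxDl rmorphD scalerDl opprD addrACA qformD addr_gt0 //.
  exact: P_gt0.
exact: P_gt0'.
Qed.

(** * Compression to the eigenspaces of an admissible matrix *)

Lemma usubmx_invmx_block_diag U lam mu (G := usubmx (invmx U)) :
  U \in unitmx ->
  G *m (U *m block_diag lam mu *m U ^t*) *m G ^t* = real_diag lam.
Proof.
(* The rows of [G] are the first [p] rows of the inverse of [U], so the compression cuts out the
   upper diagonal block. This is later used both for (A + B) J and, with entries 1 and -1, for [J]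
   itself. *)
move=> Uunit; have GU : G *m U = row_mx 1%:M 0.
  by rewrite /G mul_usub_mx mulVmx // scalar_mx_block /block_mx col_mxKu.
rewrite !mulmxA GU -!mulmxA -adjmxM GU.
rewrite tr_row_mx map_col_mx !trmx1 !map_mx1 trmx0 map_mx0.
rewrite /block_diag diag_mx_row mul_block_col mul_row_col.
by rewrite !(mul0mx, mulmx1, mul1mx, addr0).
Qed.

Lemma dsubmx_invmx_block_diag U lam mu (G := dsubmx (invmx U)) :
  U \in unitmx ->
  G *m (U *m block_diag lam mu *m U ^t*) *m G ^t* = real_diag mu.
Proof.
move=> Uunit; have GU : G *m U = row_mx 0 1%:M.
  by rewrite /G mul_dsub_mx mulVmx // scalar_mx_block /block_mx col_mxKd.
rewrite !mulmxA GU -!mulmxA -adjmxM GU.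
rewrite tr_row_mx map_col_mx !trmx1 !map_mx1 trmx0 map_mx0.
rewrite /block_diag diag_mx_row mul_block_col mul_row_col.
by rewrite !(mul0mx, mulmx1, mul1mx, add0r).
Qed.

Section Compression.
Variables (U : 'M[R[i]]_(p + q)) (lam : 'I_p -> R) (mu : 'I_q -> R).
Hypotheses (UJU : in_Upq U) (lam_mu : arranged lam mu).
Let L := U *m block_diag lam (fun j => - mu j) *m U ^t*.

Lemma qform_in_Upq (v : 'rV[R[i]]_(p + q)) :
  qform J v = norm2 (v *m lsubmx U) - norm2 (v *m rsubmx U).
Proof. by rewrite -{1}UJU qform_congr qform_Jpq mulmx_lsub mulmx_rsub. Qed.

(** [G] is not tied to [U]: it will come from A + B, and [U] from A or B. The hypothesis on [G] says
    that [J] restricts to the standard norm, which is the norm identity asked for by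
    [compression_spectrum_ge]. *)
Lemma positive_compression (G : 'M[R[i]]_(p, p + q)) :
  G *m J *m G ^t* = 1%:M ->
  exists2 nu, spectrum (G *m L *m G ^t*) nu & forall i, lam i <= nu i.
Proof.
move=> GJG; have [s [lt_s_lam lt_mu_s]] := arranged_separation lam_mu.
have [lam_iso _ _] := lam_mu.
apply: (compression_spectrum_ge (F1 := lsubmx U) (F2 := rsubmx U) (b := mu)
  (s := s)) => //.
- by apply: adjmx_compression; apply: adjmx_block_diag.
- by move=> i; apply: ltW.
- by move=> j; apply: ltW.
- move=> v; rewrite qform_congr qform_block_diag -mulmx_lsub -mulmx_rsub.
  rewrite -sumrN; congr (_ + _); apply: eq_bigr => j _.
  by rewrite rmorphN mulNr.
- by move=> x; rewrite -qform_in_Upq -qform_congr GJG qform1.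
Qed.

(** Mirror image under a change of sign of [J]: the two column blocks of [U] trade places, and the
    [- mu j] lie above [- s] and the [- lam i] below it. *)
Lemma negative_compression (G : 'M[R[i]]_(q, p + q)) :
  G *m J *m G ^t* = - 1%:M ->
  exists2 nu, spectrum (G *m L *m G ^t*) nu & forall j, - mu j <= nu j.
Proof.
move=> GJG; have [s [lt_s_lam lt_mu_s]] := arranged_separation lam_mu.
have [_ mu_anti _] := lam_mu.
apply: (compression_spectrum_ge (F1 := rsubmx U) (F2 := lsubmx U)
  (b := fun i => - lam i) (s := - s)).
- by apply: adjmx_compression; apply: adjmx_block_diag.
- by move=> j j' /mu_anti; rewrite lerN2.
- by move=> j; rewrite lerN2 ltW.
- by move=> i; rewrite lerN2 ltW.
- move=> v; rewrite qform_congr qform_block_diag -mulmx_lsub -mulmx_rsub.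
  rewrite addrC -sumrN; congr (_ + _); apply: eq_bigr => i _.
  by rewrite rmorphN mulNr opprK.
- move=> x; rewrite -[LHS]opprK -qform1 -qformN -GJG qform_congr qform_in_Upq.
  by rewrite opprB.
Qed.

End Compression.

(** * The two eigenvalue inequalities for the sum *)

Section Sum.
Variables A B : 'M[R[i]]_(p + q).
Hypotheses (hA : admissible A) (hB : admissible B).

Lemma eig_lambdaD_ge m (i : 'I_m -> 'I_p) : injective i ->
  \sum_(k < m) eig_lambda A (i k) + \sum_(k < m) eig_lambda B k
  <= \sum_(k < m) eig_lambda (A + B) (i k).
Proof.
move=> i_inj.
have le_mp : (m <= p)%N by have := leq_card i i_inj; rewrite !card_ord.
pose f := widen_ord le_mp.
have [UA [lamA [muA [UAJ arrA AE eigA _]]]] := admissible_diag hA.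
have [UB [lamB [muB [UBJ arrB BE eigB _]]]] := admissible_diag hB.
have [U [lam [mu [UJU arr CE eigC _]]]] := admissible_diag (admissibleD hA hB).
have Uunit := in_Upq_unitmx UJU; pose G := usubmx (invmx U).
(* As [U] lies in U(p,q), [J] is itself of the form U [J] U^*, so the compression lemma applies to
   it. *)
have GJG : G *m J *m G ^t* = 1%:M.
  rewrite -{1}UJU Jpq_block usubmx_invmx_block_diag //.
  by rewrite -diag_const_mx; congr diag_mx; apply/rowP => k; rewrite !mxE.
have specC : spectrum (G *m (A *m J + B *m J) *m G ^t*) lam.
  rewrite -mulmxDl CE usubmx_invmx_block_diag //; apply: spectrum_real_diag.
  by case: arr.
have := compression_lidskii (i := i) (f := f) _ _ specC i_inj (fun=> erefl).
rewrite AE BE => /(_ _ _ (positive_compression UAJ arrA GJG)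
  (positive_compression UBJ arrB GJG)) le_sum.
under eq_bigr do rewrite eigA.
(* [eig_lambda B k] takes a natural number; [f k] is the same number read in ['I_p]. *)
under [X in _ + X <= _]eq_bigr do rewrite (eigB (f _)).
under [X in _ <= X]eq_bigr do rewrite eigC.
by rewrite -!rmorph_sum -rmorphD lecR.
Qed.

Lemma eig_muD_le l (j : 'I_l -> 'I_q) : injective j ->
  \sum_(k < l) eig_mu (A + B) (j k)
  <= \sum_(k < l) eig_mu A (j k) + \sum_(k < l) eig_mu B k.
Proof.
move=> j_inj.
have le_lq : (l <= q)%N by have := leq_card j j_inj; rewrite !card_ord.
pose f := widen_ord le_lq.
have [UA [lamA [muA [UAJ arrA AE _ eigA]]]] := admissible_diag hA.
have [UB [lamB [muB [UBJ arrB BE _ eigB]]]] := admissible_diag hB.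
have [U [lam [mu [UJU arr CE _ eigC]]]] := admissible_diag (admissibleD hA hB).
have Uunit := in_Upq_unitmx UJU; pose G := dsubmx (invmx U).
have GJG : G *m J *m G ^t* = - 1%:M.
  rewrite -{1}UJU Jpq_block dsubmx_invmx_block_diag // real_diagN.
  congr (- _).
  by rewrite -diag_const_mx; congr diag_mx; apply/rowP => k; rewrite !mxE.
have specC : spectrum (G *m (A *m J + B *m J) *m G ^t*) (fun k => - mu k).
  rewrite -mulmxDl CE dsubmx_invmx_block_diag //; apply: spectrum_real_diag.
  by case: arr => _ mu_anti _ k k' /mu_anti; rewrite lerN2.
have := compression_lidskii (i := j) (f := f) _ _ specC j_inj (fun=> erefl).
rewrite AE BE => /(_ _ _ (negative_compression UAJ arrA GJG)
  (negative_compression UBJ arrB GJG)).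
(* Lidskii bounds the sums of the [- mu] from below; negating gives the upper bound. *)
rewrite !sumrN -opprD lerN2 => le_sum.
under eq_bigr do rewrite eigC; under [X in X + _]eq_bigr do rewrite eigA.
under [X in _ + X]eq_bigr do rewrite (eigB (f _)).
by rewrite -!rmorph_sum -rmorphD lecR.
Qed.

End Sum.
End PseudoHermitianForms.

Theorem theorem3p1 (R : realType) (p q : nat) (A B : 'M[R[i]]_(p + q))
    (hA : admissible A) (hB : admissible B)
    (m l : nat) (i : 'I_m -> 'I_p) (j : 'I_l -> 'I_q)
    (hi : forall k k' : 'I_m, (k < k')%N -> (i k < i k')%N)
    (hj : forall k k' : 'I_l, (k < k')%N -> (j k < j k')%N) :
  \sum_(k < m) eig_lambda (A + B) (i k) >=
    \sum_(k < m) eig_lambda A (i k) + \sum_(k < m) eig_lambda B k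
  /\
  \sum_(k < l) eig_mu (A + B) (j k) <=
    \sum_(k < l) eig_mu A (j k) + \sum_(k < l) eig_mu B k.
Proof.
split; first exact: eig_lambdaD_ge (lt_homo_inj hi).
exact: eig_muD_le (lt_homo_inj hj).
Qed.
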